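(* Let $\mathcal{S}$ be a commutative semiring, $\Sigma$ a finite alphabet, and let $f\in\mathbf{MSOLEVAL}_{\mathcal{S}}$ be a word function of quantifier rank $qr(f)$. Then there are a function $\beta:\mathbb{N}\to\mathbb{N}$ and a finite vector $F=(g_1,\dots,g_{\beta(qr(f))})$ of word functions in $\mathbf{MSOLEVAL}_{\mathcal{S}}$ of length $\beta(qr(f))$, with $f=g_i$ for some $i\le\beta(qr(f))$, such that the semimodule $\mathcal{M}[F]$ generated by $F$ is stable.
   Context: Word structures: a word $w=\sigma_1\cdots\sigma_n\in\Sigma^{\star}$ (with $n=\ell(w)$, $[n]=\{1,\dots,n\}$) is represented by the relational structure $\mathcal{A}_w$ with universe $\{0\}\cup[n]$, the natural linear order $<$, and for each $a\in\Sigma$ a unary predicate $P_a=\{i\in[n]:\sigma_i=a\}$; position $0$ carries no letter. $\mathbf{MSOL}$ denotes monadic second order logic over this vocabulary (possibly extended by further unary relation symbols). $\mathbf{MSOL}$-polynomials are defined inductively. (1) If $\phi(v)$ is an $\mathbf{MSOL}$ formula with a free first-order variable $v$ and $r$ is an indeterminate or a nonzero element of $\mathcal{S}$, then $r^{|\{a: \mathcal{A}\models\phi(a)\}|}$, also written $\prod_{v:\phi(v)} r$, is a monomial; finite products of monomials are monomials. (2) Monomials are $\mathbf{MSOL}$-polynomials. (3) If $\phi(\bar R)$ is an $\mathbf{MSOL}$ formula over the vocabulary extended by a finite tuple $\bar R=(R_1,\dots,R_m)$ of new unary relation symbols, and $t$ is an $\mathbf{MSOL}$-polynomial over the extended vocabulary,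 then $\sum_{\bar R:\langle\mathcal{A},\bar R\rangle\models\phi(\bar R)} t$ is an $\mathbf{MSOL}$-polynomial over the original vocabulary. A word function $f:\Sigma^{\star}\to\mathcal{S}$ belongs to $\mathbf{MSOLEVAL}_{\mathcal{S}}$ if there is an $\mathbf{MSOL}$-polynomial over the word vocabulary and a substitution of elements of $\mathcal{S}$ for its indeterminates such that, for every word $w$, $f(w)$ is the value of the resulting expression on $\mathcal{A}_w$. The quantifier rank $qr(f)$ of $f$ is the maximal quantifier rank of the $\mathbf{MSOL}$ formulas appearing in the definition of $f$. Semimodules: $\mathcal{S}^{\Sigma^{\star}}$ is the set of word functions $\Sigma^{\star}\to\mathcal{S}$. A semimodule is a subset of $\mathcal{S}^{\Sigma^{\star}}$ closed under pointwise addition and pointwise multiplication by elements of $\mathcal{S}$; the semimodule $\mathcal{M}[F]$ generated by a finite set $F$ consists of all $\mathcal{S}$-linear combinations of elements of $F$. For a word $w$ and word function $f$, $w^{-1}f$ is the word function $u\mapsto f(w\circ u)$, where $\circ$ is concatenation. A semimodule $M$ is stable if $w^{-1}f\in M$ for all $w\in\Sigma^{\star}$ and all $f\in M$. *)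

(* Defs.v *)
From HB Require Import structures.
From mathcomp Require Import all_boot all_order all_algebra.

Set Implicit Arguments.
Unset Strict Implicit.
Unset Printing Implicit Defensive.

Import GRing.Theory.
Local Open Scope ring_scope.

(* [formula Sigma k n]: MSOL formulas over the word vocabulary extended by [k]
   unary relation symbols, with [n] first-order variables in scope.  Variables
   are de Bruijn indices.  A set quantifier binds a fresh unary symbol (index 0
   of [k.+1]), so set variables and extra unary symbols share one index space. *)
Inductive formula (Sigma : finType) : nat -> nat -> Type :=
| FEq k n of 'I_n & 'I_n : formula Sigma k n
| FLt k n of 'I_n & 'I_n : formula Sigma k n
| FLetter k n of Sigma & 'I_n : formula Sigma k n
| FRel k n of 'I_k & 'I_n : formula Sigma k n
| FNot k n of formula Sigma k n : formula Sigma k n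
| FAnd k n of formula Sigma k n & formula Sigma k n : formula Sigma k n
| FOr k n of formula Sigma k n & formula Sigma k n : formula Sigma k n
| FEx1 k n of formula Sigma k n.+1 : formula Sigma k n
| FAll1 k n of formula Sigma k n.+1 : formula Sigma k n
| FEx2 k n of formula Sigma k.+1 n : formula Sigma k n
| FAll2 k n of formula Sigma k.+1 n : formula Sigma k n.

Fixpoint formula_qr (Sigma : finType) k n (phi : formula Sigma k n) : nat :=
  match phi with
  | FEq _ _ _ _ | FLt _ _ _ _ | FLetter _ _ _ _ | FRel _ _ _ _ => 0
  | FNot _ _ p => formula_qr p
  | FAnd _ _ p q | FOr _ _ p q => maxn (formula_qr p) (formula_qr q)
  | FEx1 _ _ p | FAll1 _ _ p | FEx2 _ _ p | FAll2 _ _ p => (formula_qr p).+1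
  end.

(* The universe {0} U [n] of the word structure; position i >= 1 carries the
   i-th letter (stored at index i - 1 of the sequence), position 0 carries none. *)
Definition pos (Sigma : finType) (w : seq Sigma) : finType := 'I_(size w).+1.

Definition letter_at (Sigma : finType) (w : seq Sigma) (a : Sigma) (i : pos w) :
    bool :=
  (0 < (i : nat))%N && (onth w (i : nat).-1 == Some a).

Fixpoint holds (Sigma : finType) (w : seq Sigma) k n (phi : formula Sigma k n) :
    k.-tuple {set pos w} -> n.-tuple (pos w) -> bool :=
  match phi in formula _ k n
    return k.-tuple {set pos w} -> n.-tuple (pos w) -> bool with
  | FEq _ _ x y => fun _ v => tnth v x == tnth v y
  | FLt _ _ x y => fun _ v => ((tnth v x : nat) < (tnth v y : nat))%N
  | FLetter _ _ a x => fun _ v => letter_at a (tnth v x)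
  | FRel _ _ X x => fun R v => tnth v x \in tnth R X
  | FNot _ _ p => fun R v => ~~ holds p R v
  | FAnd _ _ p q => fun R v => holds p R v && holds q R v
  | FOr _ _ p q => fun R v => holds p R v || holds q R v
  | FEx1 _ _ p => fun R v => [exists x : pos w, holds p R [tuple of x :: v]]
  | FAll1 _ _ p => fun R v => [forall x : pos w, holds p R [tuple of x :: v]]
  | FEx2 _ _ p =>
      fun R v => [exists X : {set pos w}, holds p [tuple of X :: R] v]
  | FAll2 _ _ p =>
      fun R v => [forall X : {set pos w}, holds p [tuple of X :: R] v]
  end.

Inductive base (S : comPzSemiRingType) : Type :=
| Indet of nat
| Coef (s : S) of s != 0.
Arguments Indet {S}.

Inductive monomial (S : comPzSemiRingType) (Sigma : finType) (k : nat) : Type :=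
| MPow of formula Sigma k 1 & base S
| MMul of monomial S Sigma k & monomial S Sigma k.

(* In [PSum m phi t], the [m] new symbols occupy the indices 0, ..., m - 1, the
   symbols already in scope are shifted by [m]. *)
Inductive msolpoly (S : comPzSemiRingType) (Sigma : finType) : nat -> Type :=
| PMono k of monomial S Sigma k : msolpoly S Sigma k
| PSum k m of formula Sigma (m + k) 0 & msolpoly S Sigma (m + k) :
    msolpoly S Sigma k.

Fixpoint monomial_qr (S : comPzSemiRingType) (Sigma : finType) k
    (t : monomial S Sigma k) : nat :=
  match t with
  | MPow phi _ => formula_qr phi
  | MMul t1 t2 => maxn (monomial_qr t1) (monomial_qr t2)
  end.

Fixpoint msolpoly_qr (S : comPzSemiRingType) (Sigma : finType) k
    (t : msolpoly S Sigma k) : nat :=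
  match t with
  | PMono _ t => monomial_qr t
  | PSum _ _ phi t => maxn (formula_qr phi) (msolpoly_qr t)
  end.

Definition base_eval (S : comPzSemiRingType) (s : nat -> S) (r : base S) : S :=
  match r with Indet i => s i | Coef c _ => c end.

Fixpoint monomial_eval (S : comPzSemiRingType) (Sigma : finType)
    (s : nat -> S) (w : seq Sigma) k (t : monomial S Sigma k)
    (R : k.-tuple {set pos w}) : S :=
  match t with
  | MPow phi r => base_eval s r ^+ #|[set x : pos w | holds phi R [tuple x]]|
  | MMul t1 t2 => monomial_eval s t1 R * monomial_eval s t2 R
  end.

Fixpoint msolpoly_eval (S : comPzSemiRingType) (Sigma : finType)
    (s : nat -> S) (w : seq Sigma) k (t : msolpoly S Sigma k) :
    k.-tuple {set pos w} -> S :=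
  match t in msolpoly _ _ k return k.-tuple {set pos w} -> S with
  | PMono _ t => fun R => monomial_eval s t R
  | PSum k m phi t => fun R =>
      \sum_(Q : m.-tuple {set pos w} | holds phi [tuple of Q ++ R] [tuple])
        msolpoly_eval s t [tuple of Q ++ R]
  end.

Definition word_fun (S : comPzSemiRingType) (Sigma : finType) : Type :=
  seq Sigma -> S.

Definition msol_defines (S : comPzSemiRingType) (Sigma : finType)
    (t : msolpoly S Sigma 0) (s : nat -> S) (f : word_fun S Sigma) : Prop :=
  forall w : seq Sigma, f w = msolpoly_eval s t ([tuple] : 0.-tuple {set pos w}).

Definition MSOLEVAL (S : comPzSemiRingType) (Sigma : finType)
    (f : word_fun S Sigma) : Prop :=
  exists (t : msolpoly S Sigma 0) (s : nat -> S), msol_defines t s f.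

Record semimodule (S : comPzSemiRingType) (Sigma : finType) := Semimodule {
  in_semimodule :> word_fun S Sigma -> Prop;
  semimodule_add : forall f g : word_fun S Sigma,
    in_semimodule f -> in_semimodule g -> in_semimodule (fun w => f w + g w);
  semimodule_scale : forall (c : S) (f : word_fun S Sigma),
    in_semimodule f -> in_semimodule (fun w => c * f w)
}.

Definition lin_comb (S : comPzSemiRingType) (Sigma : finType) n
    (F : n.-tuple (word_fun S Sigma)) (f : word_fun S Sigma) : Prop :=
  exists c : 'I_n -> S, forall w, f w = \sum_(i < n) c i * tnth F i w.

Lemma lin_comb_add (S : comPzSemiRingType) (Sigma : finType) n
    (F : n.-tuple (word_fun S Sigma)) (f g : word_fun S Sigma) :
  lin_comb F f -> lin_comb F g -> lin_comb F (fun w => f w + g w).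
Proof.
move=> [c fE] [d gE]; exists (fun i => c i + d i) => w.
by rewrite fE gE -big_split; apply: eq_bigr => i _; rewrite mulrDl.
Qed.

Lemma lin_comb_scale (S : comPzSemiRingType) (Sigma : finType) n
    (F : n.-tuple (word_fun S Sigma)) (c : S) (f : word_fun S Sigma) :
  lin_comb F f -> lin_comb F (fun w => c * f w).
Proof.
move=> [d fE]; exists (fun i => c * d i) => w.
by rewrite fE mulr_sumr; apply: eq_bigr => i _; rewrite mulrA.
Qed.

Definition generated (S : comPzSemiRingType) (Sigma : finType) n
    (F : n.-tuple (word_fun S Sigma)) : semimodule S Sigma :=
  Semimodule (@lin_comb_add S Sigma n F) (@lin_comb_scale S Sigma n F).

Definition left_quotient (S : comPzSemiRingType) (Sigma : finType)
    (w : seq Sigma) (f : word_fun S Sigma) : word_fun S Sigma :=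
  fun u => f (w ++ u).

Definition stable (S : comPzSemiRingType) (Sigma : finType)
    (M : semimodule S Sigma) : Prop :=
  forall (w : seq Sigma) (f : word_fun S Sigma), M f -> M (left_quotient w f).

(* Main.v *)
(** The rank-[r] MSOL type of a word with parameters ranges over a finite set,
    every set of types is definable, and the type of [a :: u] is computed from
    that of [u] once it is known which parameters are, or contain, position 0
    of [a :: u].  The positions of [u] become the positions [1, 2, ...] of
    [a :: u], so position 0 of [u] becomes the one carrying [a].

    Replace the formulas of the given polynomial by sets of types: only finitely
    many word functions arise.  On [a :: u], a sum over sets splits according to
    which of them contain the new position, and the new position contributes to
    a power [r ^ #{x | phi x}] a factor [r] or [1] depending on the type of [u].
    Restricting to the types for which that factor is constant makes it a scalar,
    so that the quotient by [a] is a linear combination of functions of the same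
    finite family, each restricted to a set of types of [u]. *)
Require Import Defs.
From HB Require Import structures.
From mathcomp Require Import all_boot all_order all_algebra.

Set Implicit Arguments.
Unset Strict Implicit.
Unset Printing Implicit Defensive.

Import GRing.Theory.
Local Open Scope ring_scope.

(** * Closure of definable predicates under logical operations *)

Section Definability.

Variable Sigma : finType.

Definition word_pred k n : Type :=
  forall w : seq Sigma, k.-tuple {set pos w} -> n.-tuple (pos w) -> bool.

Definition definable k n (P : word_pred k n) : Prop :=
  exists phi : formula Sigma k n, forall w R v, holds phi R v = P w R v.

Lemma definable_ext k n (P Q : word_pred k n) :
  (forall w R v, P w R v = Q w R v) -> definable P -> definable Q.
Proof. by move=> PQ [phi phiP]; exists phi => w R v; rewrite phiP PQ. Qed.

Lemma definable_not k n (P : word_pred k n) :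
  definable P -> definable (fun w R v => ~~ P w R v).
Proof. by move=> [phi phiP]; exists (FNot phi) => w R v; rewrite /= phiP. Qed.

Lemma definable_and k n (P Q : word_pred k n) :
  definable P -> definable Q -> definable (fun w R v => P w R v && Q w R v).
Proof.
by move=> [phi phiP] [psi psiP]; exists (FAnd phi psi) => w R v; rewrite /= phiP psiP.
Qed.

Lemma definable_ex1 k n (P : word_pred k n.+1) :
  definable P ->
  definable (fun w R v => [exists x, P w R [tuple of x :: v]]).
Proof.
move=> [phi phiP]; exists (FEx1 phi) => w R v /=.
by apply: eq_existsb => x; rewrite phiP.
Qed.

Lemma definable_ex2 k n (P : word_pred k.+1 n) :
  definable P ->
  definable (fun w R v => [exists X, P w [tuple of X :: R] v]).
Proof.
move=> [phi phiP]; exists (FEx2 phi) => w R v /=.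
by apply: eq_existsb => X; rewrite phiP.
Qed.

Lemma definable_true k n : definable (fun w (_ : k.-tuple _) (_ : n.-tuple _) => true).
Proof.
(* A tautology without free variables, so that it is available for [n = 0] and [k = 0]: no position
   lies below itself. *)
exists (FNot (FEx1 (FLt Sigma k ord0 ord0))) => w R v /=.
by apply/existsP => -[x]; rewrite ltnn.
Qed.

Lemma definable_eqb k n (P : word_pred k n) (b : bool) :
  definable P -> definable (fun w R v => P w R v == b).
Proof.
case: b => dP; first by apply: definable_ext dP => w R v; rewrite eqb_id.
by apply: definable_ext (definable_not dP) => w R v; rewrite eqbF_neg.
Qed.

Lemma definable_forall k n (I : finType) (P : I -> word_pred k n) :
  (forall i, definable (P i)) ->
  definable (fun w R v => [forall i, P i w R v]).
Proof.
move=> dP; suff dall (r : seq I) : definable (fun w R v => all (fun i => P i w R v) r).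
  apply: definable_ext (dall (enum I)) => w R v.
  apply/allP/forallP => [H i|H i _]; last exact: H.
  by apply: H; rewrite mem_enum.
elim: r => [|i r IHr]; first exact: definable_true.
exact: definable_and (dP i) IHr.
Qed.

Lemma definable_eq_set k n (I : finType) (A : {set I})
    (X : forall w, k.-tuple {set pos w} -> n.-tuple (pos w) -> {set I}) :
  (forall i, definable (fun w R v => i \in X w R v)) ->
  definable (fun w R v => X w R v == A).
Proof.
move=> dX; apply: (definable_ext (P := fun w R v =>
    [forall i, (i \in X w R v) == (i \in A)])).
  move=> w R v; apply/forallP/eqP => [H|-> i //].
  by apply/setP => i; apply/eqP.
by apply: definable_forall => i; apply: definable_eqb.
Qed.

End Definability.

(** * Finite sets of MSOL types and their definability *)

Section Types.

Variable Sigma : finType.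

(* From left to right: equality, order, letters, membership in a unary symbol,
   being position 0.  Making the last one atomic keeps the rank unchanged when
   a letter is prepended. *)
Definition atom k n : finType :=
  ('I_n * 'I_n + ('I_n * 'I_n + (Sigma * 'I_n + ('I_k * 'I_n + 'I_n))))%type.

Definition atom_formula k n (A : atom k n) : formula Sigma k n :=
  match A with
  | inl (i, j) => FEq Sigma k i j
  | inr (inl (i, j)) => FLt Sigma k i j
  | inr (inr (inl (b, i))) => FLetter k b i
  | inr (inr (inr (inl (X, i)))) => FRel Sigma X i
  | inr (inr (inr (inr i))) =>
      FNot (FEx1 (FLt Sigma k ord0 (lift ord0 i)))
  end.

(** Hintikka types of back-and-forth games: the atomic facts, then the types of one rank less
    reachable by adding a position, then those reachable by adding a set. *)
Fixpoint mso_type (r k n : nat) : finType :=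
  match r with
  | 0 => {set atom k n}
  | r.+1 => ({set atom k n} * {set mso_type r k n.+1} * {set mso_type r k.+1 n})%type
  end.

Definition atoms_true k n (w : seq Sigma) (R : k.-tuple {set pos w})
    (v : n.-tuple (pos w)) : {set atom k n} :=
  [set A | holds (atom_formula A) R v].

Fixpoint type_of r k n (w : seq Sigma) (R : k.-tuple {set pos w})
    (v : n.-tuple (pos w)) : mso_type r k n :=
  match r with
  | 0 => atoms_true R v
  | r.+1 => (atoms_true R v,
             [set type_of r R [tuple of x :: v] | x : pos w],
             [set type_of r [tuple of X :: R] v | X : {set pos w}])
  end.

Definition type_atoms r k n : mso_type r k n -> {set atom k n} :=
  match r with 0 => id | r.+1 => fun T => T.1.1 end.

Lemma type_atomsE r k n w (R : k.-tuple {set pos w}) (v : n.-tuple (pos w)) :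
  type_atoms (type_of r R v) = atoms_true R v.
Proof. by case: r. Qed.

Lemma definable_type_eq r k n (T : mso_type r k n) :
  definable (fun w R v => type_of r R v == T).
Proof.
have datoms k' n' (A : {set atom k' n'}) :
    definable (fun w (R : k'.-tuple {set pos w}) v => atoms_true R v == A).
  apply: definable_eq_set => i; exists (atom_formula i) => w R v.
  by rewrite inE.
elim: r k n T => [|r IHr] k n T; first exact: datoms.
case: T => -[A T1] T2.
apply: (definable_ext (P := fun w R v => (atoms_true R v == A) &&
   (([set type_of r R [tuple of x :: v] | x : pos w] == T1) &&
    ([set type_of r [tuple of X :: R] v | X : {set pos w}] == T2)))).
  by move=> w R v; rewrite /= !xpair_eqE andbA.
apply: definable_and; first exact: datoms.
apply: definable_and; apply: definable_eq_set => i.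
  apply: definable_ext (definable_ex1 (IHr _ _ i)) => w R v.
  by apply/existsP/imsetP => [[x /eqP <-]|[x _ ->]]; exists x.
apply: definable_ext (definable_ex2 (IHr _ _ i)) => w R v.
by apply/existsP/imsetP => [[x /eqP <-]|[x _ ->]]; exists x.
Qed.

Lemma definable_type_in r k n (A : {set mso_type r k n}) :
  definable (fun w R v => type_of r R v \in A).
Proof.
(* Membership is rewritten as a finite conjunction of implications, one for each type. *)
have d : definable (fun w (R : k.-tuple {set pos w}) v =>
    [forall T, ~~ (type_of r R v == T) || (T \in A)]).
  apply: definable_forall => T; case: (T \in A).
    by apply: definable_ext (definable_true Sigma k n) => w R v; rewrite orbT.
  apply: definable_ext (definable_not (definable_type_eq T)) => w R v.
  by rewrite orbF.
apply: definable_ext d => w R v.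
apply/forallP/idP => [/(_ (type_of r R v))|TA T]; first by rewrite eqxx.
by case: eqP => //= <-.
Qed.

(** Atoms are recorded at every rank, connectives act as set operations on types, and a quantifier
    inspects the matching component of a type one rank higher. *)
Lemma holds_type r k n (phi : formula Sigma k n) : (formula_qr phi <= r)%N ->
  exists A : {set mso_type r k n},
    forall w R v, holds (w := w) phi R v = (type_of r R v \in A).
Proof.
have atomA r' k' n' (A : atom k' n') : exists B : {set mso_type r' k' n'},
    forall w R v, holds (w := w) (atom_formula A) R v = (type_of r' R v \in B).
  exists [set T | A \in type_atoms T] => w R v.
  by rewrite inE type_atomsE inE.
elim: phi r => {k n} [k n i j|k n i j|k n b i|k n X i|k n p IHp|k n p IHp q IHq
    |k n p IHp q IHq|k n p IHp|k n p IHp|k n p IHp|k n p IHp] r /=.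
- by move=> _; apply: (atomA r k n (inl (i, j))).
- by move=> _; apply: (atomA r k n (inr (inl (i, j)))).
- by move=> _; apply: (atomA r k n (inr (inr (inl (b, i))))).
- by move=> _; apply: (atomA r k n (inr (inr (inr (inl (X, i)))))).
- by move=> /IHp[A pA]; exists (~: A) => w R v; rewrite inE pA.
- rewrite geq_max => /andP[/IHp[A pA] /IHq[B qB]].
  by exists (A :&: B) => w R v; rewrite inE pA qB.
- rewrite geq_max => /andP[/IHp[A pA] /IHq[B qB]].
  by exists (A :|: B) => w R v; rewrite inE pA qB.
- case: r => // r /IHp[A pA].
  exists [set T : mso_type r.+1 k n | [exists U in T.1.2, U \in A]] => w R v.
  rewrite inE /=; apply/existsP/exists_inP => [[x]|[U /imsetP[x _ ->] UA]].
    by rewrite pA => xA; eexists; [apply: imset_f|exact: xA].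
  by exists x; rewrite pA.
- case: r => // r /IHp[A pA].
  exists [set T : mso_type r.+1 k n | [forall U in T.1.2, U \in A]] => w R v.
  rewrite inE /=; apply/forallP/forall_inP => [H U /imsetP[x _ ->]|H x].
    by rewrite -pA.
  by rewrite pA; apply: H; apply: imset_f.
- case: r => // r /IHp[A pA].
  exists [set T : mso_type r.+1 k n | [exists U in T.2, U \in A]] => w R v.
  rewrite inE /=; apply/existsP/exists_inP => [[x]|[U /imsetP[x _ ->] UA]].
    by rewrite pA => xA; eexists; [apply: imset_f|exact: xA].
  by exists x; rewrite pA.
- case: r => // r /IHp[A pA].
  exists [set T : mso_type r.+1 k n | [forall U in T.2, U \in A]] => w R v.
  rewrite inE /=; apply/forallP/forall_inP => [H U /imsetP[x _ ->]|H x].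
    by rewrite -pA.
  by rewrite pA; apply: H; apply: imset_f.
Qed.

End Types.

(** * How types change when a letter is prepended *)

Section Prepend.

Variables (Sigma : finType) (a : Sigma).

Definition shift (u : seq Sigma) (x : pos u) : pos (a :: u) := lift ord0 x.

Definition origin (u : seq Sigma) : pos u := ord0.

Definition shift_set (u : seq Sigma) (b : bool) (X : {set pos u}) :
    {set pos (a :: u)} :=
  [set y | if unlift ord0 y is Some x then x \in X else b].

(** For [b = true] the position [x] is a placeholder; keeping it lets flags and positions be paired
    entry by entry. *)
Definition shift_pos (u : seq Sigma) (b : bool) (x : pos u) : pos (a :: u) :=
  if b then origin (a :: u) else shift x.

Definition map2_tuple (A B C : Type) (f : A -> B -> C) k (s : k.-tuple A) (t : k.-tuple B) :
    k.-tuple C := [tuple f (tnth s i) (tnth t i) | i < k].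

Lemma map2_tuple_cons A B C (f : A -> B -> C) k x y (s : k.-tuple A) (t : k.-tuple B) :
  map2_tuple f [tuple of x :: s] [tuple of y :: t] =
  [tuple of f x y :: map2_tuple f s t].
Proof.
apply: eq_from_tnth => i; rewrite tnth_mktuple.
case: (unliftP ord0 i) => [j|] ->; first by rewrite !tnthS tnth_mktuple.
by rewrite !tnth0.
Qed.

Lemma map2_tuple_cat A B C (f : A -> B -> C) m k (s : m.-tuple A) (t : m.-tuple B)
    (s' : k.-tuple A) (t' : k.-tuple B) :
  map2_tuple f [tuple of s ++ s'] [tuple of t ++ t'] =
  [tuple of map2_tuple f s t ++ map2_tuple f s' t'].
Proof.
apply: eq_from_tnth => i; rewrite tnth_mktuple.
by case: (split_ordP i) => j ->; rewrite ?tnth_lshift ?tnth_rshift tnth_mktuple.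
Qed.

Lemma shift_posP u (y : pos (a :: u)) : exists b (x : pos u), y = shift_pos b x.
Proof.
case: (unliftP ord0 y) => [x|] ->; first by exists false, x.
by exists true, (origin u).
Qed.

Lemma mem_shift_set u b (X : {set pos u}) c x :
  (shift_pos c x \in shift_set b X) = if c then b else x \in X.
Proof.
rewrite inE; case: c; last by rewrite liftK.
by rewrite unlift_none.
Qed.

Definition trace_set u (Y : {set pos (a :: u)}) : {set pos u} :=
  [set x | shift x \in Y].

Lemma shift_setK u (Y : {set pos (a :: u)}) :
  shift_set (origin (a :: u) \in Y) (trace_set Y) = Y.
Proof.
apply/setP => y; case: (shift_posP y) => b [x ->].
by rewrite mem_shift_set; case: b; rewrite ?inE.
Qed.

Lemma trace_setK u b (X : {set pos u}) : trace_set (shift_set b X) = X.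
Proof. by apply/setP => x; rewrite inE (mem_shift_set b X false). Qed.

Lemma origin_shift_set u b (X : {set pos u}) :
  (origin (a :: u) \in shift_set b X) = b.
Proof. exact: (mem_shift_set b X true (origin u)). Qed.

Definition shift_sets u k := map2_tuple (k := k) (@shift_set u).
Definition shift_vars u n := map2_tuple (k := n) (@shift_pos u).

(** The new position lies below all others and carries no letter; the old position 0 acquires the
    letter [a], which is why being position 0 must be readable from [T]. *)
Definition prepend_atoms k n (B : k.-tuple bool) (Z : n.-tuple bool)
    (T : {set atom Sigma k n}) : {set atom Sigma k n} :=
  [set A : atom Sigma k n | match A with
  | inl (i, j) => if tnth Z i || tnth Z j then tnth Z i && tnth Z j else A \in T
  | inr (inl (i, j)) => ~~ tnth Z j && (tnth Z i || (A \in T))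
  | inr (inr (inl (b, i))) => ~~ tnth Z i &&
      ((A \in T) || (inr (inr (inr (inr i))) \in T) && (a == b))
  | inr (inr (inr (inl (X, i)))) => if tnth Z i then tnth B X else A \in T
  | inr (inr (inr (inr i))) => tnth Z i
  end].

(* Variables flagged by [Z] are interpreted by position 0 of [a :: u]; their
   value in the type over [u] is irrelevant. *)
Fixpoint prepend r k n (B : k.-tuple bool) (Z : n.-tuple bool) :
    mso_type Sigma r k n -> mso_type Sigma r k n :=
  match r with
  | 0 => prepend_atoms B Z
  | r.+1 => fun T =>
    (prepend_atoms B Z T.1.1,
     prepend B [tuple of true :: Z] @: T.1.2 :|:
       prepend B [tuple of false :: Z] @: T.1.2,
     prepend [tuple of true :: B] Z @: T.2 :|:
       prepend [tuple of false :: B] Z @: T.2)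
  end.

Lemma holds_origin k n (i : 'I_n) w (R : k.-tuple {set pos w}) v :
  holds (atom_formula (inr (inr (inr (inr i))))) R v = (tnth v i == origin w).
Proof.
rewrite /=; apply/existsPn/eqP => [/(_ (origin w))|H x].
  by rewrite tnth0 tnthS -leqNgt leqn0 => /eqP H; apply: val_inj.
by rewrite tnthS H.
Qed.

Lemma atoms_true_prepend u k n (R : k.-tuple {set pos u}) (v : n.-tuple (pos u)) B Z :
  atoms_true (shift_sets B R) (shift_vars Z v) = prepend_atoms B Z (atoms_true R v).
Proof.
apply/setP; case=> [[i j]|[[i j]|[[b i]|[[X i]|i]]]]; rewrite !inE.
- rewrite /= !tnth_mktuple /shift_pos /shift.
  case: (tnth Z i); case: (tnth Z j) => //=; rewrite -val_eqE //=.
- rewrite /= !tnth_mktuple /shift_pos /shift.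
  by case: (tnth Z i); case: (tnth Z j).
- rewrite holds_origin /= !tnth_mktuple /shift_pos /shift.
  case: (tnth Z i) => //=; rewrite /letter_at -val_eqE.
  (* Position 0 of [u] is now the one carrying [a]; every later position keeps its letter. *)
  case: (tnth v i) => -[|m] lt_m /=; first by apply/eqP/eqP => [[]|->].
  by rewrite orbF.
- by rewrite /= !tnth_mktuple mem_shift_set.
- by rewrite holds_origin !tnth_mktuple /shift_pos; case: (tnth Z i).
Qed.

(** Every position or set of [a :: u] arises from one of [u] and a flag, so each component of the
    new type is a union of two images, one for each flag. *)
Lemma type_of_prepend r u k n (R : k.-tuple {set pos u}) (v : n.-tuple (pos u)) B Z :
  type_of r (shift_sets B R) (shift_vars Z v) = prepend B Z (type_of r R v).
Proof.
elim: r k n R v B Z => [|r IHr] k n R v B Z; first exact: atoms_true_prepend.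
rewrite /= atoms_true_prepend; congr (_, _, _); apply/setP => T; rewrite inE.
  apply/imsetP/orP => [[y _ ->]|].
    case: (shift_posP y) => b [x ->].
    rewrite -map2_tuple_cons IHr.
    by case: b; [left|right]; apply: imset_f; apply: imset_f.
  by case=> /imsetP[_ /imsetP[x _ ->] ->]; rewrite -IHr /shift_vars map2_tuple_cons;
    eexists.
apply/imsetP/orP => [[Y _ ->]|].
  rewrite -(shift_setK Y) -map2_tuple_cons IHr.
  by case: (_ \in Y); [left|right]; apply: imset_f; apply: imset_f.
by case=> /imsetP[_ /imsetP[X _ ->] ->]; rewrite -IHr /shift_sets map2_tuple_cons;
  eexists.
Qed.

Lemma type_of_prepend0 r u k (R : k.-tuple {set pos u}) B :
  type_of r (shift_sets B R) [tuple] = prepend B [tuple] (type_of r R [tuple]).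
Proof. by rewrite -type_of_prepend; congr type_of; apply: eq_from_tnth => -[]. Qed.

Lemma type_of_prepend1 r u k (R : k.-tuple {set pos u}) B b (x : pos u) :
  type_of r (shift_sets B R) [tuple shift_pos b x] =
  prepend B [tuple b] (type_of r R [tuple x]).
Proof.
rewrite -type_of_prepend; congr type_of; apply: eq_from_tnth => i.
by rewrite tnth_mktuple (ord1 i).
Qed.

(** A set of positions of [a :: u] is determined by whether it contains position 0 and by its trace
    on [u]. *)
Lemma big_shift_sets (T : nmodType) u m (F : m.-tuple {set pos (a :: u)} -> T) :
  \sum_Q F Q = \sum_(B : m.-tuple bool) \sum_(Q : m.-tuple {set pos u}) F (shift_sets B Q).
Proof.
rewrite pair_big /=.
rewrite (reindex (fun p : m.-tuple bool * m.-tuple {set pos u} => shift_sets p.1 p.2)) //=.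
exists (fun Q => (map_tuple (fun Y : {set pos (a :: u)} => origin _ \in Y) Q,
                  map_tuple (@trace_set u) Q)) => [[B Q] _|Q _] /=.
  congr (_, _); apply: eq_from_tnth => i; rewrite tnth_map tnth_mktuple.
    exact: origin_shift_set.
  exact: trace_setK.
by apply: eq_from_tnth => i; rewrite tnth_mktuple !tnth_map shift_setK.
Qed.

End Prepend.

Arguments type_of : simpl never.
Arguments prepend : simpl never.

(** * Finite families closed under quotient by a letter *)

Section QuotientFamilies.

Variables (S : comPzSemiRingType) (Sigma : finType) (s : nat -> S) (r : nat).

Definition word_map k : Type := forall w : seq Sigma, k.-tuple {set pos w} -> S.

(* One rank more than the formulas under the powers: whether the new position
   satisfies such a formula is a sentence of rank [r.+1] about [u]. *)
Definition restricted_comb k (I : Type) (G : I -> word_map k)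
    (l : seq (S * {set mso_type Sigma r.+1 k 0} * I)) : word_map k :=
  fun w R => \sum_(q <- l) q.1.1 * (type_of r.+1 R [tuple] \in q.1.2)%:R * G q.2 w R.

(** The list may depend on the letter and the flags, but must serve all [u] and [R] at once. *)
Definition quotient_closed k (I : Type) (G : I -> word_map k) : Prop :=
  forall i a (B : k.-tuple bool), exists l, forall u (R : k.-tuple {set pos u}),
    G i (a :: u) (shift_sets a B R) = restricted_comb G l R.

Lemma mono_family k (t : monomial S Sigma k) : (monomial_qr t <= r)%N ->
  exists (I : finType) (G : I -> word_map k),
    [/\ forall i, exists t', forall w R, G i w R = monomial_eval s t' R,
        exists i, forall w R, G i w R = monomial_eval s t R
      & quotient_closed G].
Proof.
elim: t => [phi b|t1 IH1 t2 IH2] /=; last first.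
  rewrite geq_max => /andP[/IH1[I1 [G1 [def1 [i1 i1E] cl1]]] /IH2[I2 [G2 [def2 [i2 i2E] cl2]]]].
  exists (I1 * I2)%type, (fun i w R => G1 i.1 w R * G2 i.2 w R); split.
  - case=> i j; case: (def1 i) => t1' t1E; case: (def2 j) => t2' t2E.
    by exists (MMul t1' t2') => w R; rewrite /= t1E t2E.
  - by exists (i1, i2) => w R; rewrite i1E i2E.
  case=> i j a B; case: (cl1 i a B) => l1 l1E; case: (cl2 j a B) => l2 l2E.
  (* Multiplying out the two combinations multiplies scalars and intersects restrictions. *)
  exists [seq (p.1.1 * q.1.1, p.1.2 :&: q.1.2, (p.2, q.2)) | p <- l1, q <- l2] => u R.
  rewrite l1E l2E /restricted_comb big_allpairs_dep big_distrlr /=.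
  apply: eq_bigr => p _; apply: eq_bigr => q _; rewrite inE.
  by rewrite -mulnb natrM mulrACA; congr (_ * _); rewrite mulrACA.
move=> /holds_type[A0 A0E].
pose c := base_eval s b.
exists {set mso_type Sigma r k 1},
  (fun (A : {set mso_type Sigma r k 1}) w (R : k.-tuple {set pos w}) =>
     c ^+ #|[set x : pos w | type_of r R [tuple x] \in A]|); split.
- move=> A; case: (definable_type_in A) => psi psiE.
  exists (MPow psi b) => w R /=; congr (_ ^+ _).
  by apply: eq_card => x; rewrite !inE psiE.
- exists A0 => w R; congr (_ ^+ _).
  by apply: eq_card => x; rewrite !inE A0E.
move=> A a B.
(* [A'] decides which old positions are counted, [C] whether the new one is. In [C] the variable of
   [U] is a flagged placeholder, so any position of [u] may witness it. *)
pose A' := [set T | prepend a B [tuple false] T \in A].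
pose C := [set T : mso_type Sigma r.+1 k 0 |
  [exists U in T.1.2, prepend a B [tuple true] U \in A]].
(* The new position contributes the factor [c] on [C] and [1] off [C]. *)
exists [:: (c, C, A'); (1, ~: C, A')] => u R.
have memC : (type_of r.+1 R [tuple] \in C) =
    (type_of r (shift_sets a B R) [tuple origin (a :: u)] \in A).
  have originE (x : pos u) := type_of_prepend1 a r R B true x.
  rewrite inE; apply/exists_inP/idP => [[_ /imsetP[x _ ->]]|oA].
    by rewrite -originE.
  exists (type_of r R [tuple origin u]); first exact: imset_f.
  by rewrite -originE.
have -> : #|[set x : pos (a :: u) | type_of r (shift_sets a B R) [tuple x] \in A]| =
    ((type_of r.+1 R [tuple] \in C) +
     #|[set x : pos u | type_of r R [tuple x] \in A']|)%N.
  rewrite memC -!sum1_card big_mkcond [X in _ = (_ + X)%N]big_mkcond /=.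
  rewrite big_ord_recl !inE; congr (_ + _)%N.
  by apply: eq_bigr => x _; rewrite !inE -(type_of_prepend1 a r R B false x).
rewrite /restricted_comb !big_cons big_nil addr0 in_setC.
case: (_ \in C); first by rewrite mulr0 mul0r addr0 mulr1 exprS.
by rewrite mulr0 mul0r add0r !mul1r.
Qed.

Lemma poly_family k (t : msolpoly S Sigma k) : (msolpoly_qr t <= r)%N ->
  exists (I : finType) (G : I -> word_map k),
    [/\ forall i, exists t', forall w R, G i w R = msolpoly_eval s t' R,
        exists i, forall w R, G i w R = msolpoly_eval s t R
      & quotient_closed G].
Proof.
elim: t => {k} [k t|k m phi t IHt] /=.
  move=> /mono_family[I [G [def ex cl]]]; exists I, G; split=> // i.
  by case: (def i) => t' t'E; exists (PMono t').
rewrite geq_max => /andP[phi_r /IHt[I [G [def [i0 i0E] cl]]]].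
(* Guards are taken at rank [r.+1] so that they can absorb the restrictions of [restricted_comb]. *)
have [A0 A0E] := holds_type (leqW phi_r).
exists ({set mso_type Sigma r.+1 (m + k) 0} * I)%type.
exists (fun (i : {set mso_type Sigma r.+1 (m + k) 0} * I) w (R : k.-tuple {set pos w}) =>
  \sum_(Q : m.-tuple {set pos w} |
    type_of r.+1 [tuple of Q ++ R] [tuple] \in i.1) G i.2 w [tuple of Q ++ R]).
split.
- case=> A i; case: (def i) => t' t'E; case: (definable_type_in A) => psi psiE.
  exists (PSum psi t') => w R; apply: eq_big => Q; first by rewrite psiE.
  by move=> _; apply: t'E.
- exists (A0, i0) => w R; apply: eq_big => Q; first by rewrite A0E.
  by move=> _; apply: i0E.
case=> A i a B.
have [l lE] := fin_all_exists (fun B' : m.-tuple bool => cl i a [tuple of B' ++ B]).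
pose A' (B' : m.-tuple bool) := [set T | prepend a [tuple of B' ++ B] [tuple] T \in A].
(* The restriction in [q] concerns the summed sets too, so it moves into the guard of the sum,
   leaving [setT] outside. *)
exists [seq (q.1.1, setT, (q.1.2 :&: A' B', q.2))
   | B' <- enum {: m.-tuple bool}, q <- l B'] => u R.
rewrite /restricted_comb big_allpairs_dep big_enum /= big_mkcond big_shift_sets.
apply: eq_bigr => B' _.
under [RHS]eq_bigr => q _ do rewrite inE mulr1 big_mkcond mulr_sumr.
rewrite exchange_big; apply: eq_bigr => Q _ /=.
rewrite /shift_sets -map2_tuple_cat -/(shift_sets _ _ _) type_of_prepend0 lE.
rewrite /restricted_comb.
under [RHS]eq_bigr => q _ do rewrite !inE.
case: (_ \in A); last first.
  by rewrite big1 // => q _; rewrite andbF mulr0.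
apply: eq_bigr => q _; rewrite andbT.
by case: (_ \in _); rewrite ?mulr1 // !mulr0 mul0r.
Qed.

End QuotientFamilies.

(** * Linear combinations and stability *)

Section Generated.

Variables (S : comPzSemiRingType) (Sigma : finType).
Variables (n : nat) (F : n.-tuple (word_fun S Sigma)).

(** Several terms may use the same generator; their coefficients are added up. *)
Lemma lin_comb_sum (J : Type) (l : seq J) (c : J -> S) (i : J -> 'I_n) :
  lin_comb F (fun u => \sum_(j <- l) c j * tnth F (i j) u).
Proof.
exists (fun p => \sum_(j <- l | i j == p) c j) => u.
under [RHS]eq_bigr => p _ do rewrite mulr_suml big_mkcond.
rewrite exchange_big; apply: eq_bigr => j _ /=.
by rewrite -big_mkcond (big_pred1 (i j)) // => p; rewrite /= eq_sym.
Qed.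

Lemma lin_comb_ext (f g : word_fun S Sigma) : f =1 g -> lin_comb F f -> lin_comb F g.
Proof. by move=> fg [c fE]; exists c => w; rewrite -fg fE. Qed.

(** A quotient by a word is a succession of quotients by letters, each of which is linear, so
    generators and letters suffice. *)
Lemma stable_generated :
  (forall i a, lin_comb F (fun u => tnth F i (a :: u))) -> stable (generated F).
Proof.
move=> clF; elim=> [|a w IHw] f /= Ff; first by apply: lin_comb_ext Ff.
apply: (IHw (fun u => f (a :: u))); case: Ff => c fE.
have [d dE] := fin_all_exists (fun i => clF i a).
exists (fun j => \sum_i c i * d i j) => u; rewrite fE.
under eq_bigr => i _ do rewrite dE mulr_sumr.
rewrite exchange_big; apply: eq_bigr => j _ /=.
by rewrite mulr_suml; apply: eq_bigr => i _; rewrite mulrA.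
Qed.

End Generated.

Theorem theorem11 (S : comPzSemiRingType) (Sigma : finType)
    (f : word_fun S Sigma) (t : msolpoly S Sigma 0) (s : nat -> S)
    (hf : msol_defines t s f) :
  exists (beta : nat -> nat)
         (F : (beta (msolpoly_qr t)).-tuple (word_fun S Sigma)),
    [/\ forall i, MSOLEVAL (tnth F i),
        exists i, f =1 tnth F i
      & stable (generated F)].
Proof.
pose r := msolpoly_qr t.
have [I [G [def [i0 i0E] cl]]] := poly_family s (leqnn r).
pose K := ({set mso_type Sigma r.+1 0 0} * I)%type : finType.
(* Making the restriction part of the generator turns restricted combinations into plain linear
   ones. *)
pose g (p : K) : word_fun S Sigma := fun w =>
  (type_of r.+1 ([tuple] : 0.-tuple {set pos w}) [tuple] \in p.1)%:R * G p.2 w [tuple].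
pose F : #|K|.-tuple (word_fun S Sigma) := [tuple g (enum_val i) | i < #|K|].
have FE p : tnth F (enum_rank p) = g p by rewrite tnth_mktuple enum_rankK.
(* With [t] fixed, [beta] is constant, equal to the size of the index set. *)
exists (fun _ => #|K|), F; split.
- move=> i; rewrite tnth_mktuple; case: (enum_val i) => A j.
  have [t' t'E] := def j; have [psi psiE] := definable_type_in A.
  (* A sum over the unique empty tuple of sets turns its guard into a 0/1 factor. *)
  exists (PSum (m := 0) psi t'), s => w /=.
  rewrite big_mkcond (big_pred1 [tuple]) => [|Q]; last by rewrite (tuple0 Q); apply/esym/eqP.
  suff gE (Q : 0.-tuple {set pos w}) :
      g (A, j) w = if type_of r.+1 Q [tuple] \in A then G j w Q else 0.
    by rewrite psiE -t'E; apply: gE.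
  by rewrite (tuple0 Q) /g /=; case: (_ \in A); rewrite ?mul1r ?mul0r.
- exists (enum_rank (setT, i0)) => w.
  by rewrite FE /g inE mul1r i0E hf.
apply: stable_generated => i a; rewrite tnth_mktuple.
case: (enum_val i) => A j.
have [l lE] := cl j a [tuple].
pose A' := [set T | prepend a [tuple] [tuple] T \in A].
(* The restriction to [A] on [a :: u] becomes one to [A'] on [u], and meets the restriction of each
   term in an intersection. *)
apply: lin_comb_ext (lin_comb_sum F l (fun q => q.1.1)
  (fun q => enum_rank (A' :&: q.1.2, q.2))) => u.
rewrite /g /=.
have -> : ([tuple] : 0.-tuple {set pos (a :: u)}) =
    shift_sets a [tuple] ([tuple] : 0.-tuple {set pos u}).
  by apply: eq_from_tnth => -[].
rewrite type_of_prepend0 lE /restricted_comb mulr_sumr.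
apply: eq_bigr => q _; rewrite FE /g /= !inE.
by case: (_ \in A); case: (_ \in q.1.2); rewrite /= ?mul1r ?mul0r ?mulr1 ?mulr0 ?mul0r.
Qed.
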